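(* Suppose $p<q$, let $A=(a_1,\ldots,a_p)$ and $B=(b_1,\ldots,b_q)$ be parameter vectors, and put $f_1=\prod_{i=1}^{p}a_i\big/\prod_{i=1}^{q}b_i$. (i) If $$e_{q-i}(b_1,\ldots,b_q)\ge e_{p-i}(a_1,\ldots,a_p),\qquad i=0,1,\ldots,p,$$ then for $x\ge0$ $${}_pF_q(A;B;x)\le 1-f_1+f_1e^x.$$ (ii) If $$\frac{e_q(b_1,\ldots,b_q)}{e_p(a_1,\ldots,a_p)}\le\frac{e_{q-1}(b_1,\ldots,b_q)}{e_{p-1}(a_1,\ldots,a_p)}\le\cdots\le\frac{e_{q-p+1}(b_1,\ldots,b_q)}{e_1(a_1,\ldots,a_p)}\le e_{q-p}(b_1,\ldots,b_q),$$ then for $x\ge0$ $${}_pF_q(A;B;x)\le e^{f_1x}.$$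
   Context: ${}_pF_q(A;B;x)=\sum_{n\ge 0}\frac{(a_1)_n\cdots(a_p)_n}{(b_1)_n\cdots(b_q)_n\,n!}x^n$, where $b_j\notin\{0,-1,-2,\ldots\}$ and $(a)_0=1$, $(a)_n=a(a+1)\cdots(a+n-1)$ for $n\ge1$. The elementary symmetric polynomials are $e_0=1$ and $e_k(x_1,\ldots,x_m)=\sum_{1\le j_1<j_2<\cdots<j_k\le m}x_{j_1}x_{j_2}\cdots x_{j_k}$ for $k=1,\ldots,m$.
   Formalization: The parameters are taken real with all a_i ≥ 0 and all b_j > 0, since without sign conditions the claim fails (e.g. (i) with p=1, q=2, a=-1, b=(1/2,1/2)); in (ii) e_1(a),…,e_p(a) are assumed nonzero so that the quotients are defined. *)

(* Defs.v *)
From mathcomp Require Import all_boot all_order all_algebra.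
From mathcomp Require mpoly.
From mathcomp Require Import all_classical all_reals all_analysis.

Set Implicit Arguments.
Unset Strict Implicit.
Unset Printing Implicit Defensive.

Import Order.TTheory GRing.Theory Num.Theory.
Import numFieldNormedType.Exports.

Local Open Scope ring_scope.

Definition pochhammer (R : realType) (a : R) (n : nat) : R :=
  \prod_(k < n) (a + k%:R).

Definition hypergeom_coeff (R : realType) (p q : nat)
    (a : 'I_p -> R) (b : 'I_q -> R) (x : R) : R^nat := fun n =>
  (\prod_(i < p) pochhammer (a i) n) /
  ((\prod_(j < q) pochhammer (b j) n) * (n`!)%:R) * x ^+ n.

(* The sum is a total [limn] of partial sums, in the style of [expR]. It is
   meaningful when no [b j] is a nonpositive integer and the series converges;
   the latter holds for every [x] when [p <= q]. *)
Definition hypergeom (R : realType) (p q : nat)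
    (a : 'I_p -> R) (b : 'I_q -> R) (x : R) : R :=
  limn (series (hypergeom_coeff a b x)).

Definition elemsym (R : realType) (m k : nat) (x : 'I_m -> R) : R :=
  mpoly.meval x (mpoly.mesym m R k).

(* Main.v *)
(** Writing [u n] for the n-th ratio of Pochhammer products, one has
    [u (n + 1) / u n = \prod_i (a i + n) / \prod_j (b j + n)]. Expanding both
    products in powers of [n], the hypotheses compare the coefficients of
    [n ^ i] for [i <= p], and the remaining terms of the denominator are
    nonnegative. In case (i) the ratio is at most 1, so [u n <= u 1 = f1] for
    [n >= 1]; in case (ii) it is at most [f1], so [u n <= f1 ^ n]. Both bounds
    are then summed against [x ^ n / n!]. *)

Require Import Defs.
From mathcomp Require Import all_boot all_order all_algebra.
From mathcomp Require Import all_classical all_reals all_analysis.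

Set Implicit Arguments.
Unset Strict Implicit.
Unset Printing Implicit Defensive.

Import Order.TTheory GRing.Theory Num.Theory.
Import numFieldNormedType.Exports.

Local Open Scope ring_scope.

(** This subset form matches the sum that [bigA_distr] produces when a product of binomials is
    expanded. *)
Lemma elemsymE (R : realType) (m k : nat) (x : 'I_m -> R) :
  elemsym k x = \sum_(h : {set 'I_m} | #|h| == k) \prod_(i in h) x i.
Proof.
rewrite /elemsym /mpoly.mesym.
rewrite (big_morph _ (mpoly.mevalD x) (mpoly.meval0 x)).
apply: eq_bigr => h _; rewrite (big_morph _ (mpoly.mevalM x) (mpoly.meval1 x)).
by apply: eq_bigr => i _; exact: mpoly.mevalXU.
Qed.

Lemma elemsym_ge0 (R : realType) (m k : nat) (x : 'I_m -> R) :
  (forall i, 0 <= x i) -> 0 <= elemsym k x.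
Proof.
by move=> x0; rewrite elemsymE sumr_ge0 // => h _; rewrite prodr_ge0.
Qed.

Lemma elemsym0 (R : realType) (m : nat) (x : 'I_m -> R) : elemsym 0 x = 1.
Proof.
rewrite elemsymE (eq_bigl (pred1 finset.set0)); last first.
  by move=> h; rewrite cards_eq0.
by rewrite big_pred1_eq big_set0.
Qed.

Lemma elemsym_full (R : realType) (m : nat) (x : 'I_m -> R) :
  elemsym m x = \prod_(i < m) x i.
Proof.
rewrite elemsymE (eq_bigl (pred1 [set: 'I_m]%SET)); last first.
  move=> h; rewrite /= eqEcard finset.subsetT cardsT card_ord eqn_leq.
  by have := max_card (mem h); rewrite card_ord => ->.
by rewrite big_pred1_eq; apply: eq_bigl => i; rewrite finset.in_setT.
Qed.

(** Each subset [h] in the expansion collects the factors that contribute [x i]; the other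
    [m - #|h|] factors contribute [t], so grouping by that number yields the powers of [t]. *)
Lemma prod_addr_elemsym (R : realType) (m : nat) (x : 'I_m -> R) (t : R) :
  \prod_(i < m) (x i + t) = \sum_(k < m.+1) elemsym (m - k) x * t ^+ k.
Proof.
have card_le (h : {set 'I_m}) : (#|h| <= m)%N.
  by have := max_card (mem h); rewrite card_ord.
rewrite bigA_distr /=.
under eq_bigr => h _ do rewrite big_if /= prodr_const.
rewrite (partition_big
  (fun h : {set 'I_m} => inord (m - #|h|) : 'I_m.+1) xpredT)//=.
apply: eq_bigr => k _; rewrite elemsymE mulr_suml.
have kE (h : {set 'I_m}) :
    (inord (m - #|h|) == k :> 'I_m.+1) = (#|h| == m - k)%N.
  rewrite -val_eqE /= inordK ?ltnS ?leq_subr//.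
  by apply/eqP/eqP => [<-|->]; rewrite subKn// -ltnS.
apply: eq_big => [h|h]; first by rewrite kE.
rewrite kE => /eqP hk; congr (_ * _ ^+ _).
have := cardsC h; rewrite card_ord hk => hC.
by rewrite -[LHS]cardsE -(addKn (m - k) #|_|) hC subKn // -ltnS.
Qed.

Lemma ler_prod_addr (R : realType) (p q : nat) (a : 'I_p -> R) (b : 'I_q -> R)
    (c t : R) :
  (p <= q)%N -> (forall j, 0 <= b j) -> 0 <= t ->
  (forall i, (i <= p)%N -> c * elemsym (p - i) a <= elemsym (q - i) b) ->
  c * \prod_(i < p) (a i + t) <= \prod_(j < q) (b j + t).
Proof.
move=> pq b0 t0 cab; rewrite !prod_addr_elemsym.
(* Padding the shorter sum with zeros up to degree [q] allows a termwise comparison. *)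
rewrite (big_ord_widen q.+1 (fun k => elemsym (p - k) a * t ^+ k)) ?ltnS//.
rewrite mulr_sumr big_mkcond; apply: ler_sum => k _.
case: ifPn => [|_]; last by rewrite mulr_ge0 ?elemsym_ge0 ?exprn_ge0.
by rewrite ltnS => kp; rewrite mulrA ler_wpM2r ?exprn_ge0 ?cab.
Qed.

Lemma pochhammerS (R : realType) (a : R) (n : nat) :
  pochhammer a n.+1 = pochhammer a n * (a + n%:R).
Proof. exact: big_ord_recr. Qed.

(** The sequence [u] of the overview: the factorial is left out so that it stays with
    [exp_coeff]. *)
Definition pochhammer_ratio (R : realType) (p q : nat)
    (a : 'I_p -> R) (b : 'I_q -> R) (n : nat) : R :=
  (\prod_(i < p) pochhammer (a i) n) / \prod_(j < q) pochhammer (b j) n.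

Lemma hypergeom_coeffE (R : realType) (p q : nat)
    (a : 'I_p -> R) (b : 'I_q -> R) (x : R) (n : nat) :
  hypergeom_coeff a b x n = pochhammer_ratio a b n * exp_coeff x n.
Proof.
rewrite /hypergeom_coeff /pochhammer_ratio /exp_coeff /= invfM.
by rewrite -!mulrA [_^-1 * x ^+ n]mulrC.
Qed.

Lemma pochhammer_ratio0 (R : realType) (p q : nat)
    (a : 'I_p -> R) (b : 'I_q -> R) : pochhammer_ratio a b 0 = 1.
Proof.
rewrite /pochhammer_ratio !big1 ?divr1// => i _; exact: big_ord0.
Qed.

Lemma pochhammer_ratioS (R : realType) (p q : nat)
    (a : 'I_p -> R) (b : 'I_q -> R) (n : nat) :
  pochhammer_ratio a b n.+1 = pochhammer_ratio a b n *
    ((\prod_(i < p) (a i + n%:R)) / \prod_(j < q) (b j + n%:R)).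
Proof.
rewrite /pochhammer_ratio.
under eq_bigr do rewrite pochhammerS.
under [in X in _ / X]eq_bigr do rewrite pochhammerS.
by rewrite !big_split /= invfM mulrACA.
Qed.

Lemma pochhammer_ratio_ge0 (R : realType) (p q : nat)
    (a : 'I_p -> R) (b : 'I_q -> R) (n : nat) :
  (forall i, 0 <= a i) -> (forall j, 0 <= b j) -> 0 <= pochhammer_ratio a b n.
Proof.
by move=> a0 b0; apply: divr_ge0; apply: prodr_ge0 => i _;
  apply: prodr_ge0 => k _; rewrite addr_ge0.
Qed.

(** The constant [c] serves both cases: it is 1 in (i) and [f1^-1] in (ii). *)
Lemma pochhammer_ratioS_le (R : realType) (p q : nat)
    (a : 'I_p -> R) (b : 'I_q -> R) (c : R) (n : nat) :
  (p <= q)%N -> (forall i, 0 <= a i) -> (forall j, 0 < b j) -> 0 < c ->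
  (forall i, (i <= p)%N -> c * elemsym (p - i) a <= elemsym (q - i) b) ->
  pochhammer_ratio a b n.+1 <= pochhammer_ratio a b n * c^-1.
Proof.
move=> pq a0 b0 c0 cab; have b0' j : 0 <= b j by exact: ltW.
rewrite pochhammer_ratioS ler_wpM2l ?pochhammer_ratio_ge0//.
rewrite ler_pdivrMr ?ler_pdivlMl ?ler_prod_addr ?ler0n//.
by rewrite prodr_gt0 // => j _; rewrite ltr_wpDr.
Qed.

Lemma series_exp_coeff_le (R : realType) (x : R) (n : nat) :
  0 <= x -> series (exp_coeff x) n <= expR x.
Proof.
move=> x0; apply: nondecreasing_cvgn_le; last exact: is_cvg_series_exp_coeff.
by apply: nondecreasing_series => k _ _; exact: exp_coeff_ge0.
Qed.

(** The partial sums increase, so a uniform bound gives both convergence and the estimate of the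
    limit. Bounding only nonempty sums lets the induction in case (i) start from the constant
    term. *)
Lemma hypergeom_le (R : realType) (p q : nat)
    (a : 'I_p -> R) (b : 'I_q -> R) (x M : R) :
  (forall i, 0 <= a i) -> (forall j, 0 <= b j) -> 0 <= x ->
  (forall n, series (hypergeom_coeff a b x) n.+1 <= M) -> hypergeom a b x <= M.
Proof.
move=> a0 b0 x0 hM.
have nd : nondecreasing_seq (series (hypergeom_coeff a b x)).
  apply: nondecreasing_series => n _ _.
  by rewrite hypergeom_coeffE mulr_ge0 ?exp_coeff_ge0 ?pochhammer_ratio_ge0.
have leM n : series (hypergeom_coeff a b x) n <= M.
  by rewrite (le_trans _ (hM n)) ?nd.
apply: limr_le; last exact: nearW.
by apply: nondecreasing_is_cvgn => //; exists M => _ [n _ <-].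
Qed.

Theorem theorem9 (R : realType) (p q : nat) (hpq : (p < q)%N)
    (a : 'I_p -> R) (b : 'I_q -> R)
    (ha : forall i, 0 <= a i) (hb : forall j, 0 < b j) :
  let f1 := (\prod_(i < p) a i) / (\prod_(j < q) b j) in
  ((forall i : nat, (i <= p)%N -> elemsym (p - i)%N a <= elemsym (q - i)%N b) ->
   forall x : R, 0 <= x -> hypergeom a b x <= 1 - f1 + f1 * expR x)
  /\
  ((forall k : nat, (1 <= k <= p)%N -> elemsym k a != 0) ->
   (forall i : nat, (i < p)%N ->
      elemsym (q - i)%N b / elemsym (p - i)%N a <=
      elemsym (q - i.+1)%N b / elemsym (p - i.+1)%N a) ->
   forall x : R, 0 <= x -> hypergeom a b x <= expR (f1 * x)).
Proof.
move=> f1; have pq := ltnW hpq.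
have hb0 j : 0 <= b j by exact: ltW.
have b0 : 0 < \prod_(j < q) b j by rewrite prodr_gt0.
have f10 : 0 <= f1 by rewrite divr_ge0 ?prodr_ge0.
split=> [hab x x0|ha_neq0 hmono x x0].
- have ratioS n : pochhammer_ratio a b n.+1 <= pochhammer_ratio a b n.
    rewrite -[leRHS]mulr1 -[X in _ * X]invr1.
    by apply: pochhammer_ratioS_le => // i ip; rewrite mul1r hab.
  have ratio_le n : pochhammer_ratio a b n.+1 <= f1.
    elim: n => [|n]; last exact: le_trans.
    rewrite pochhammer_ratioS pochhammer_ratio0 mul1r.
    by under eq_bigr do rewrite addr0;
       under [in X in _ / X <= _]eq_bigr do rewrite addr0.
  apply: hypergeom_le => // n.
  (* The summand [1 - f1] corrects the constant term, whose ratio is 1 and not [f1]; every later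
     term is bounded by [f1] times that of the exponential. *)
  apply: (@le_trans _ _ (1 - f1 + f1 * series (exp_coeff x) n.+1)); last first.
    by rewrite lerD2l ler_wpM2l ?series_exp_coeff_le.
  elim: n => [|n ih].
    rewrite !seriesSr hypergeom_coeffE pochhammer_ratio0 /series /= !big_geq//.
    by rewrite /exp_coeff /= expr0 fact0 divr1 !add0r !mulr1 subrK.
  rewrite seriesSr [in leRHS]seriesSr mulrDr addrA lerD//.
  by rewrite hypergeom_coeffE ler_wpM2r ?exp_coeff_ge0.
(* Positive denominators let the quotient inequalities be cleared into the coefficient inequalities
   used above. *)
- have ea_gt0 i : (i <= p)%N -> 0 < elemsym (p - i) a.
    move=> ip; rewrite lt_def elemsym_ge0// andbT.
    case: (posnP (p - i)) => [->|pi0]; first by rewrite elemsym0 oner_neq0.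
    by rewrite ha_neq0 // pi0 leq_subr.
  have f1V : f1^-1 = elemsym q b / elemsym p a.
    by rewrite /f1 invf_div !elemsym_full.
  have f1_gt0 : 0 < f1.
    by rewrite divr_gt0// -elemsym_full; have := ea_gt0 0 isT; rewrite subn0.
  (* The monotone chain starts at [f1^-1], which is therefore a lower bound for all its
     quotients. *)
  have f1V_le i : (i <= p)%N ->
      f1^-1 <= elemsym (q - i) b / elemsym (p - i) a.
    elim: i => [|i ih] ip; first by rewrite !subn0 f1V.
    exact: le_trans (ih (ltnW ip)) (hmono _ ip).
  have ratio_le n : pochhammer_ratio a b n <= f1 ^+ n.
    elim: n => [|n ih]; first by rewrite pochhammer_ratio0.
    apply: (@le_trans _ _ (pochhammer_ratio a b n * f1^-1^-1)).
      apply: pochhammer_ratioS_le; rewrite ?invr_gt0// => i ip.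
      by rewrite -ler_pdivlMr ?ea_gt0 ?f1V_le.
    by rewrite invrK exprSr ler_wpM2r.
  apply: hypergeom_le => // n.
  (* The powers [f1 ^+ k] are absorbed into the argument, giving partial sums of the exponential at
     [f1 * x]. *)
  apply: le_trans (series_exp_coeff_le n.+1 (mulr_ge0 f10 x0)).
  rewrite /series /=; apply: ler_sum => k _.
  rewrite hypergeom_coeffE /exp_coeff /= exprMn -[leRHS]mulrA.
  by rewrite ler_wpM2r // divr_ge0 ?exprn_ge0.
Qed.
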